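(* Let $n, t, k_1, \ldots, k_t$ be positive integers with $n \geq \sum_{i=1}^t k_i$. Let $\mathcal{F}_1, \ldots, \mathcal{F}_t$ be families of subsets of $[n]$ such that for each $1 \leq i \leq t$, $\mathcal{F}_i$ only contains sets of size $k_i$ and $|\mathcal{F}_i| > (t-1)\binom{n-1}{k_i-1}$. Then there exist $t$ pairwise disjoint sets $F_1 \in \mathcal{F}_1, \ldots, F_t \in \mathcal{F}_t$.
   Context: $[n] = \{1, \ldots, n\}$. The families $\mathcal{F}_1,\ldots,\mathcal{F}_t$ are sets of subsets (no repeated members within a family), but they need not be distinct or disjoint from one another. *)

(* Defs.v *)
From mathcomp Require Export all_boot.
Set Implicit Arguments.
Unset Strict Implicit.
Unset Printing Implicit Defensive.

(* Main.v *)
Require Import Defs.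
From mathcomp Require Import all_boot all_fingroup.
Set Implicit Arguments.
Unset Strict Implicit.
Unset Printing Implicit Defensive.

(** Write t for the number of families, X for the ground set and n for its
    cardinal.  The proof is by induction on n.

    If the sizes k_i add up to exactly n, fix an ordered partition (P_i) of X
    with #|P_i| = k_i and move it by a uniformly random permutation s of X.
    Each s(P_i) is a uniformly random k_i-subset of X, so it misses F_i with
    probability 1 - #|F_i| / 'C(n, k_i) < 1 - (t - 1) k_i / n.  These bounds add
    up to t - (t - 1) = 1, hence by the union bound some s sends every P_i into
    F_i ([rainbow_spanning]).

    If the k_i add up to less than n, the union bound is too weak and a point z
    of X is removed instead.  Compressing all the families simultaneously, by
    moving z to x in their members whenever this gives a new set, keeps the
    sizes and creates no rainbow system of disjoint sets
    ([compress_rainbow]).  So z may be assumed to be replaceable, in any member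
    containing it, by any point outside of that member
    ([reduce_replaceable]).  By Pascal's rule, for each i either the members
    of F_i avoiding z, or the members containing z with z deleted, are numerous
    enough on X minus z.  The induction hypothesis gives disjoint sets in these
    n - 1 points; those that lost z are completed with distinct fresh points of X
    (there is room, the k_i adding up to at most n), and replaceability shows
    that the completed sets are members of the families ([rainbow_matching]).

    Deleting z may empty the sets of a family, so that the induction must allow
    k_i = 0; [star_card] is the form of the bound that survives this. *)

(** * Counting stars *)

Definition ksubsets (T : finType) (X : {set T}) (k : nat) : {set {set T}} :=
  [set A : {set T} | A \subset X & #|A| == k].

(** The number of k-subsets of an n-set through a given point.  It differs from
    'C(n - 1, k - 1) at k = 0, where truncated subtraction would give 1. *)
Definition star_card (n k : nat) : nat :=
  if k is k'.+1 then 'C(n.-1, k') else 0.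

Definition rainbow (T I : finType) (F : I -> {set {set T}}) : Prop :=
  exists S : I -> {set T},
    (forall i, S i \in F i) /\ (forall i j, i != j -> [disjoint S i & S j]).

(** Double counting of the pairs made of a point and a k-subset containing it. *)
Lemma star_card_mul n k : n * star_card n k = k * 'C(n, k).
Proof.
case: k => [|k]; first by rewrite muln0 mul0n.
by case: n => [|n]; [rewrite bin0n muln0 | rewrite mul_bin_diag].
Qed.

Lemma star_cardS n k : 0 < n ->
  star_card n.+1 k.+1 = star_card n k.+1 + star_card n k.
Proof. by case: n k => [|n] [|k] //= _; rewrite ?bin0 ?addn0 ?binS. Qed.

(** * Random ordered partitions *)

Lemma ltn_sum_at (I : finType) (f g : I -> nat) (i0 : I) :
  (forall i, f i <= g i) -> f i0 < g i0 -> \sum_i f i < \sum_i g i.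
Proof.
move=> le_fg lt_fg; rewrite (bigD1 i0) //= [X in _ < X](bigD1 i0) //= -addSn.
by rewrite leq_add // leq_sum.
Qed.

Section Families.
Variables T I : finType.
Implicit Types (X A B P : {set T}) (F : I -> {set {set T}}) (k : I -> nat).

(** Provides both the partition that is permuted at random when the sizes add
    up to #|X|, and the fresh points that complete the sets of the induction
    step (with sizes 0 and 1). *)
Lemma disjoint_system X k : \sum_i k i <= #|X| ->
  exists P : I -> {set T}, (forall i, P i \in ksubsets X (k i)) /\
    (forall i j, i != j -> [disjoint P i & P j]).
Proof.
move=> le_kX.
suff [P sP dP] : exists2 P : I -> {set T},
    {in enum I, forall i, P i \in ksubsets X (k i)} &
    {in enum I &, forall i j, i != j -> [disjoint P i & P j]}.
  by exists P; split=> [i | i j]; [apply: sP | apply: dP]; rewrite mem_enum.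
have {le_kX}: \sum_(i <- enum I) k i <= #|X| by rewrite big_enum.
elim: (enum I) (enum_uniq I) X => [|a r IHr] /=; first by exists (fun=> set0).
case/andP=> a_r /IHr{}IHr X; rewrite big_cons => le_kX.
have le_aX: k a <= #|X| by rewrite (leq_trans _ le_kX) ?leq_addr.
have: 0 < #|ksubsets X (k a)| by rewrite cards_draws bin_gt0.
case/card_gt0P=> A AX; move: (AX); rewrite inE => /andP[sAX /eqP kA].
have [|P sP dP] := IHr (X :\: A).
  by rewrite cardsD (setIidPr sAX) kA leq_subRL.
exists (fun i => if i == a then A else P i) => [i | i j].
  rewrite inE; case: eqVneq => [-> //| _ /= /sP].
  rewrite !inE => /andP[sPX ->]; rewrite andbT.
  exact: subset_trans sPX (subsetDl _ _).
have dA l : l \in r -> [disjoint A & P l].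
  move/sP; rewrite inE subsetD disjoint_sym => /andP[/andP[_ //]].
rewrite !inE; case: (eqVneq i a) => [->|_] /=.
  by case: (eqVneq j a) => [-> | _] //= _ jr _; rewrite dA.
case: (eqVneq j a) => [-> | _] //= ir; last exact: dP.
by move=> _ _; rewrite disjoint_sym dA.
Qed.

Lemma disjoint_perm (s : {perm T}) A B :
  [disjoint s @: A & s @: B] = [disjoint A & B].
Proof. exact: imset_disjoint (@perm_inj _ s). Qed.

Lemma mem_tperm_imset (z x y : T) A :
  (y \in tperm z x @: A) = (tperm z x y \in A).
Proof. by rewrite -{1}(tpermK z x y) mem_imset //; apply: perm_inj. Qed.

(** As long as A differs from B, swapping a point of A \ B with a point of B \ A
    brings A one point closer to B. *)
Lemma Sym_transitive X A B : A \subset X -> B \subset X -> #|A| = #|B| ->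
  exists2 s : {perm T}, s \in Sym X & s @: A = B.
Proof.
move=> + sBX; have [m] := ubnP #|A :\: B|.
elim: m A => // m IHm A le_m sAX eqAB.
have [AB0 | [a]] := set_0Vmem (A :\: B).
  exists 1%g; first exact: group1.
  have /eqP <- : A == B by rewrite eqEcard eqAB leqnn andbT -setD_eq0 AB0.
  by rewrite (eq_imset (g := id)) ?imset_id // => x; rewrite perm1.
rewrite inE => /andP[aB aA].
have [b] : exists b, b \in B :\: A.
  apply/card_gt0P; rewrite cardsD setIC -eqAB -cardsD.
  by apply/card_gt0P; exists a; rewrite inE aB.
rewrite inE => /andP[bA bB].
pose t := tperm a b.
have tX : t \in Sym X.
  rewrite inE; apply/subsetP=> x; rewrite inE /t.
  case: tpermP => [-> _ | -> _ | _ _]; last by rewrite eqxx.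
    exact: (subsetP sAX).
  exact: (subsetP sBX).
have tA x : (x \in t @: A) = (t x \in A) by apply: mem_tperm_imset.
have [||| s sX sB] := IHm (t @: A).
- rewrite -ltnS; apply: leq_trans le_m; rewrite ltnS; apply: proper_card.
  apply/properP; split; last first.
    by exists a; rewrite !inE ?aB // tA tpermL (negPf bA) andbF.
  apply/subsetP=> x; rewrite !inE tA /t => /andP[xB].
  by case: tpermP xB => [-> | -> | _ _ -> ->//]; rewrite ?bB // aB.
- apply/subsetP=> x; rewrite tA /t; case: tpermP => [-> _ | -> _ | _ _] //.
  + exact: (subsetP sAX).
  + exact: (subsetP sBX).
  + exact: (subsetP sAX).
- by rewrite card_imset //; apply: perm_inj.
exists (t * s)%g; first by rewrite groupM.
by rewrite -sB -imset_comp; apply: eq_imset => x; rewrite permM.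
Qed.

(** The image of P under a uniformly random permutation of X is a uniformly
    random m-subset of X: by transitivity all the m-subsets are hit equally
    often.  Denominators are cleared to stay in nat. *)
Lemma Sym_count X m P (E : {set {set T}}) :
  P \in ksubsets X m -> E \subset ksubsets X m ->
  #|[set s in Sym X | s @: P \in E]| * 'C(#|X|, m) = #|E| * #|Sym X|.
Proof.
move=> PX.
pose N A := #|[set s in Sym X | s @: P == A]|.
have NE (D : {set {set T}}) : D \subset ksubsets X m ->
    #|[set s in Sym X | s @: P \in D]| = #|D| * N P.
  move=> /subsetP sD; rewrite -sum_nat_const -sum1_card.
  rewrite (partition_big (fun s : {perm T} => s @: P) (mem D)) /=; last first.
    by move=> s; rewrite inE => /andP[].
  apply: eq_bigr => A DA; rewrite sum1_card.
  move: (sD _ DA) PX; rewrite !inE => /andP[sAX /eqP kA] /andP[sPX /eqP kP].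
  have [|g gX gA] := Sym_transitive sPX sAX; first by rewrite kP.
  (* right multiplication by g maps the stabiliser of P onto the permutations
     that send P to A *)
  rewrite /N -[RHS](card_imset _ (mulIg g)); apply: eq_card => s.
  rewrite [LHS]inE /= !inE; apply/andP/imsetP.
    case=> /andP[sX _] /eqP sA; exists (s * g^-1)%g; last by rewrite mulgKV.
    rewrite inE; apply/andP; split; first by rewrite groupM ?groupV // inE.
    apply/eqP; rewrite (eq_imset (g := g^-1%g \o s)) => [|x]; last by rewrite permM.
    rewrite imset_comp sA -gA -imset_comp.
    by rewrite (eq_imset (g := id)) ?imset_id // => x /=; rewrite permK.
  case=> h; rewrite inE => /andP[hX /eqP hP] ->.
  have -> : (h * g)%g @: P = A.
    rewrite (eq_imset (g := g \o h)) => [|x]; last by rewrite permM.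
    by rewrite imset_comp hP.
  by rewrite DA eqxx andbT; have := groupM hX gX; rewrite inE.
(* the same count with all the m-subsets in place of E gives the total *)
move=> sE; rewrite NE // -mulnA; congr (_ * _).
rewrite mulnC -cards_draws -NE //.
apply: eq_card => s; rewrite inE; case sX: (s \in Sym X) => //=.
move: PX; rewrite !inE => /andP[sPX /eqP kP].
rewrite card_imset ?kP ?eqxx ?andbT; last exact: perm_inj.
apply/subsetP=> _ /imsetP[x xP ->].
by rewrite perm_closed ?(subsetP sPX) //; rewrite inE in sX.
Qed.

(** The union bound, read as an expectation: the average over s of the number of
    indices i with s @: P i \in F i exceeds #|I| - 1, so some s reaches #|I|. *)
Lemma rainbow_spanning X k F :
    (forall i, F i \subset ksubsets X (k i)) -> \sum_i k i = #|X| ->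
    (forall i, #|I|.-1 * star_card #|X| (k i) < #|F i|) ->
  rainbow F.
Proof.
move=> sF sumk ltF.
have [X0 | X_gt0] := posnP #|X|.
  have k0 i : k i = 0.
    by apply/eqP; rewrite -leqn0 -X0 -sumk (bigD1 i) //= leq_addr.
  have F0 i : set0 \in F i.
    have /card_gt0P[A FA] : 0 < #|F i| by apply: leq_ltn_trans (ltF i).
    move: (subsetP (sF i) _ FA); rewrite inE k0 cards_eq0 => /andP[_ /eqP <-] //.
  by exists (fun=> set0); split=> // i j _; rewrite -setI_eq0 set0I.
have [i0 _ | noI] := pickP (mem I); last first.
  by exists (fun=> set0); split=> i; have:= noI i.
have [|P [sP dP]] := @disjoint_system X k; first by rewrite sumk.
pose G := Sym X.
pose good i := [set s in G | s @: P i \in F i].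
have ltgood i : #|I|.-1 * k i * #|G| < #|X| * #|good i|.
  have kC : 0 < 'C(#|X|, k i).
    by rewrite bin_gt0 -sumk (bigD1 i) //= leq_addr.
  rewrite -(ltn_pmul2r kC) -[X in _ < X]mulnA Sym_count //.
  rewrite mulnAC mulnA ltn_pmul2r ?cardG_gt0 // -mulnA -star_card_mul.
  by rewrite mulnCA ltn_pmul2l.
have [s /andP[sG /forallP sF'] | bad] :=
    pickP (fun s => (s \in G) && [forall i, s @: P i \in F i]).
  by exists (fun i => s @: P i); split=> // i j /dP; rewrite disjoint_perm.
have: #|I|.-1 * #|G| < \sum_i #|good i|.
  rewrite -(ltn_pmul2l X_gt0) big_distrr /= mulnCA -{1}sumk mulnA big_distrr /=.
  by rewrite big_distrl /=; apply: (ltn_sum_at (i0 := i0)) => // i; apply: ltnW.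
rewrite ltnNge; case/negP.
rewrite (eq_bigr (fun i => \sum_(s in G) (s @: P i \in F i))); last first.
  by move=> i _; rewrite -big_mkcondr -sum1_card; apply: eq_bigl => s; rewrite inE.
rewrite exchange_big /= mulnC -sum_nat_const leq_sum // => s sG.
have := bad s; rewrite sG => /negbT/forallPn[i /negPf sPi].
rewrite (bigD1 i) //= sPi add0n -(cardC1 i) -sum1_card.
by apply: leq_sum => j _; apply: leq_b1.
Qed.

Lemma tperm_exchange (z x : T) A :
  z \in A -> x \notin A -> tperm z x @: A = x |: A :\ z.
Proof.
move=> zA xA; apply/setP=> y; rewrite mem_tperm_imset !inE.
case: tpermP => [-> | -> | /eqP/negPf-> /eqP/negPf-> //].
  rewrite (negPf xA) eqxx /= orbF; apply/esym/eqP=> zx.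
  by rewrite -zx zA in xA.
by rewrite eqxx zA.
Qed.

(** * Compression *)

Definition compress (z x : T) (D : {set {set T}}) (A : {set T}) : {set T} :=
  let B := tperm z x @: A in
  if [&& z \in A, x \notin A & B \notin D] then B else A.

Lemma compress_inj z x (D : {set {set T}}) :
  {in D &, injective (compress z x D)}.
Proof.
move=> A B DA DB; rewrite /compress.
case: ifP => [/and3P[_ _ nA] | _]; case: ifP => [/and3P[_ _ nB] | _] //.
- by move/(imset_inj (@perm_inj _ _)).
- by move=> eAB; rewrite eAB DB in nA.
- by move=> eAB; rewrite -eAB DA in nB.
Qed.

Lemma compress_ksubsets X m z x (D : {set {set T}}) : x \in X ->
  D \subset ksubsets X m -> compress z x D @: D \subset ksubsets X m.
Proof.
move=> xX /subsetP sD; apply/subsetP=> _ /imsetP[A DA ->]; rewrite /compress.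
case: ifP => [/and3P[zA _ _] | _]; last exact: sD.
have:= sD _ DA; rewrite !inE => /andP[/subsetP sAX /eqP <-].
rewrite card_imset ?eqxx ?andbT; last exact: perm_inj.
apply/subsetP=> y; rewrite mem_tperm_imset.
by case: tpermP => [-> _ | -> _ | _ _ /sAX//] //; apply: sAX.
Qed.

(** A member that avoids x has not been moved, and if it contains z it can only
    have stayed because its exchanged form was already in D. *)
Lemma compress_notin z x (D : {set {set T}}) B :
    B \in compress z x D @: D -> x \notin B ->
  B \in D /\ (z \in B -> tperm z x @: B \in D).
Proof.
case/imsetP=> A DA; rewrite /compress.
case: ifP => [/and3P[zA _ _] -> | H -> xA].
  by rewrite mem_tperm_imset tpermR zA.
by split=> // zA; move: H; rewrite zA xA => /negbFE.
Qed.

Lemma compress_in z x (D : {set {set T}}) B :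
    B \in compress z x D @: D -> z \in B -> B \in D.
Proof.
case/imsetP=> A DA; rewrite /compress; case: ifP => [/and3P[_ xA _]|_] -> //.
by rewrite mem_tperm_imset tpermL (negPf xA).
Qed.

Lemma compress_mem z x (D : {set {set T}}) B :
  B \in compress z x D @: D -> B \in D \/ tperm z x @: B \in D.
Proof.
case/imsetP=> A DA; rewrite /compress; case: ifP => _ ->; last by left.
right; rewrite -imset_comp (eq_imset (g := id)) ?imset_id // => y /=.
exact: tpermK.
Qed.

(** At most one set of the compressed rainbow system contains x, so at most one
    of them, S j, is new.  Then the transposition of z and x can be applied to
    the whole system: disjointness is kept, S j returns to the member it came
    from, and each other S i avoids x, hence is either fixed or, if it
    contains z, sent into F i by [compress_notin]. *)
Lemma compress_rainbow z x F :
  rainbow (fun i => compress z x (F i) @: F i) -> rainbow F.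
Proof.
case=> S [SF dS].
have [j Sj | allF] := pickP (fun j => S j \notin F j); last first.
  by exists S; split=> // i; apply/negPn; rewrite allF.
exists (fun i => tperm z x @: S i); split=> [i | i l /dS]; last first.
  by rewrite disjoint_perm.
have xSj : x \in S j.
  apply/negPn/negP=> xSj; have [Fj _] := compress_notin (SF j) xSj.
  by case/negP: Sj.
have [-> | neq_ij] := eqVneq i j.
  by case: (compress_mem (SF j)) => // Fj; case/negP: Sj.
have xSi : x \notin S i.
  by apply/negP=> xSi; have /pred0P/(_ x) := dS _ _ neq_ij; rewrite /= xSi xSj.
have [Fi zFi] := compress_notin (SF i) xSi.
have [/zFi // | zSi] := boolP (z \in S i).
rewrite (_ : _ @: _ = S i) //; apply/setP=> y; rewrite mem_tperm_imset.
by case: tpermP => [-> | -> | //]; rewrite (negPf xSi) (negPf zSi).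
Qed.

Definition replaceable (X : {set T}) (z : T) (D : {set {set T}}) : Prop :=
  forall x A, x \in X -> A \in D -> z \in A -> x \notin A ->
    tperm z x @: A \in D.

(** Compress as long as some exchange leaves its family.  This terminates since
    each effective compression decreases the number of members containing z. *)
Lemma reduce_replaceable X z k F :
    (forall i, F i \subset ksubsets X (k i)) ->
  exists F' : I -> {set {set T}},
    [/\ forall i, F' i \subset ksubsets X (k i), forall i, #|F' i| = #|F i|,
        forall i, replaceable X z (F' i) & rainbow F' -> rainbow F].
Proof.
pose weight F := \sum_i #|[set A in F i | z \in A]|.
have [m] := ubnP (weight F); elim: m F => // m IHm F le_m sF.
pose bad i x A := [&& x \in X, A \in F i, z \in A, x \notin A &
                     tperm z x @: A \notin F i].
have [[[i x] A] /= | ok] := pickP (fun u => bad u.1.1 u.1.2 u.2); last first.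
  exists F; split=> // i x A xX FA zA xA; have:= ok (i, x, A).
  by rewrite /bad /= xX FA zA xA => /negbFE.
case/and5P=> xX FA zA xA nFA.
have sub l : [set B in compress z x (F l) @: F l | z \in B]
               \subset [set B in F l | z \in B].
  apply/subsetP=> B; rewrite [in X in X -> _]inE => /andP[FB zB].
  by rewrite inE zB (compress_in FB).
have [||F' [sF' cF' rF' rb]] := IHm (fun i => compress z x (F i) @: F i).
- rewrite -ltnS; apply: leq_trans le_m; rewrite ltnS /weight.
  apply: (ltn_sum_at (i0 := i)) => [l|]; first exact: subset_leq_card.
  apply: proper_card; apply/properP; split=> //.
  exists A; rewrite !inE ?FA ?zA // andbT; apply/negP=> cA.
  by have [_ /(_ zA)] := compress_notin cA xA; apply/negP.
- by move=> l; apply: compress_ksubsets.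
exists F'; split=> // [l | /rb]; last exact: compress_rainbow.
by rewrite cF' card_in_imset //; apply: compress_inj.
Qed.

(** * Induction on the ground set *)

Theorem rainbow_matching X k F :
    (forall i, F i \subset ksubsets X (k i)) -> \sum_i k i <= #|X| ->
    (forall i, #|I|.-1 * star_card #|X| (k i) < #|F i|) ->
  rainbow F.
Proof.
have [n cX] : {n | #|X| = n} by exists #|X|.
elim: n X cX k F => [|n IHn] X cX k F sF.
  move=> le0 ltF; apply: (rainbow_spanning sF) => //.
  by apply/eqP; rewrite eqn_leq le0 cX.
rewrite leq_eqVlt => /predU1P[/(rainbow_spanning sF) // | ].
rewrite cX ltnS => le_kn.
have /card_gt0P[z zX] : 0 < #|X| by rewrite cX.
have [F1 [sF1 cF rF rb]] := reduce_replaceable z sF.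
move=> ltF; apply: rb.
have {ltF}ltF i : #|I|.-1 * star_card n.+1 (k i) < #|F1 i|.
  by rewrite cF.
clear F sF cF; move: F1 sF1 rF ltF => F sF rF ltF.
pose Fz i := [set A in F i | z \in A].
pose link i := [set A :\ z | A in Fz i].
(* b i tells that z is deleted from the members of F i containing it, rather
   than restricting F i to the members avoiding z *)
pose b i := (0 < k i) && (#|I|.-1 * star_card n (k i).-1 < #|link i|).
pose F' i := if b i then link i else F i :\: Fz i.
have cX' : #|X :\ z| = n by move: cX; rewrite (cardsD1 z) zX => -[].
have clink i : #|link i| = #|Fz i|.
  apply: card_in_imset => A B; rewrite !inE => /andP[_ zA] /andP[_ zB] eqAB.
  by rewrite -(setD1K zA) -(setD1K zB) eqAB.
have sF' i : F' i \subset ksubsets (X :\ z) (k i - b i).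
  apply/subsetP=> A; rewrite /F'; case: ifP => _.
    case/imsetP=> B; rewrite inE => /andP[/(subsetP (sF i))+ zB] ->.
    rewrite !inE => /andP[sBX /eqP <-].
    by rewrite setSD //= (cardsD1 z B) zB addnC addnK.
  rewrite !inE => /andP[+ FA]; rewrite FA /= => zA.
  have:= subsetP (sF i) _ FA; rewrite inE => /andP[sAX /eqP <-].
  by rewrite subsetD1 sAX zA subn0 eqxx.
have [|| S [SF dS]] := IHn (X :\ z) cX' (fun i => k i - b i) F' sF'.
- rewrite cX'; apply: leq_trans le_kn; apply: leq_sum => i _; exact: leq_subr.
- move=> i; rewrite cX' /F'; case bi: (b i).
    by rewrite subn1; case/andP: bi.
  rewrite subn0 cardsD (setIidPr _); last first.
    by apply/subsetP=> A; rewrite inE => /andP[].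
  rewrite -clink ltn_subRL; move: (ltF i) bi; rewrite /b.
  case: (posnP (k i)) => [k0 | k_gt0 /=].
    rewrite k0 /= !muln0 addn0 => F_gt0 _.
    suff -> : #|link i| = 0 by [].
    rewrite clink; apply/eqP; rewrite cards_eq0; apply/set0Pn => -[A].
    rewrite inE => /andP[/(subsetP (sF i))].
    by rewrite inE k0 cards_eq0 => /andP[_ /eqP->]; rewrite inE.
  (* Pascal's rule: too small a link leaves many members avoiding z *)
  have n_gt0 : 0 < n.
    by apply: leq_trans le_kn; rewrite (bigD1 i) //= ltn_addr.
  rewrite -{1 2}(prednK k_gt0) star_cardS // prednK // => ltFi /negbT.
  rewrite -leqNgt => le_link; apply: leq_ltn_trans ltFi.
  by rewrite mulnDr addnC leq_add2l.
pose U := \bigcup_i S i.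
have cS i : #|S i| = k i - b i.
  by have:= subsetP (sF' i) _ (SF i); rewrite inE => /andP[_ /eqP].
have sSU i : S i \subset U by apply: bigcup_sup.
(* P i is a fresh point where z has been deleted, and empty elsewhere *)
have [|P [sP dP]] := @disjoint_system (X :\: U) b.
  have cU : #|U| <= \sum_i (k i - b i).
    rewrite (eq_bigr (fun i => #|S i|)) // /U.
    elim/big_ind2: _ => [|A m B p leA leB|//]; first by rewrite cards0.
    by apply: leq_trans (leq_add leA leB); rewrite cardsU leq_subr.
  rewrite cardsD; apply: leq_trans (leq_sub2l _ (subset_leq_card (subsetIr _ _))).
  rewrite cX leq_subRL; last first.
    apply: leq_trans cU (leq_trans _ (leqW le_kn)).
    by apply: leq_sum => i _; apply: leq_subr.
  apply: leq_trans (leqW le_kn); apply: leq_trans (leq_add cU (leqnn _)) _.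
  rewrite -big_split /=; apply: leq_sum => i _; rewrite subnK // /b.
  by case: (k i) => // m; apply: leq_trans (leq_b1 _) _.
have sPU i : P i \subset X :\: U.
  by have:= sP i; rewrite inE => /andP[].
have dSP i j : [disjoint S i & P j].
  apply: disjointWl (sSU i) _; rewrite disjoint_sym.
  by have:= sPU j; rewrite subsetD => /andP[].
exists (fun i => S i :|: P i); split=> [i | i j neq_ij]; last first.
  rewrite -setI_eq0 setIUl !setIUr [P i :&: S j]setIC.
  by rewrite !disjoint_setI0 ?setU0 ?dS ?dSP ?dP.
have:= sP i; have:= SF i; rewrite inE /F'; case: (b i) => /=; last first.
  by rewrite inE cards_eq0 => /andP[_ FS] /andP[_ /eqP->]; rewrite setU0.
case/imsetP=> A; rewrite inE => /andP[FA zA] SA /andP[_ /cards1P[x Px]].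
rewrite SA Px setUC.
(* the fresh point may be z itself, in which case A is recovered *)
have [-> | neq_xz] := eqVneq x z; first by rewrite setD1K.
have /setDP[xX xU] : x \in X :\: U by rewrite (subsetP (sPU i)) // Px set11.
have xA : x \notin A.
  by apply: contra xU => xA; rewrite (subsetP (sSU i)) // SA !inE neq_xz.
by rewrite -tperm_exchange //; apply: rF.
Qed.
End Families.

Theorem lemma3p1 (n t : nat) (k : 'I_t -> nat)
    (F : 'I_t -> {set {set 'I_n}})
    (n_gt0 : 0 < n) (t_gt0 : 0 < t) (k_gt0 : forall i : 'I_t, 0 < k i)
    (le_sum_n : \sum_(i < t) k i <= n)
    (F_unif : forall (i : 'I_t) (A : {set 'I_n}), A \in F i -> #|A| = k i)
    (F_card : forall i : 'I_t, (t - 1) * 'C(n - 1, k i - 1) < #|F i|) :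
  exists S : 'I_t -> {set 'I_n},
    (forall i : 'I_t, S i \in F i) /\
    (forall i j : 'I_t, i != j -> [disjoint S i & S j]).

Proof.
apply: (@rainbow_matching _ _ [set: 'I_n] k F) => [i||i].
- by apply/subsetP=> A FA; rewrite inE subsetT (F_unif i) ?eqxx.
- by rewrite cardsT card_ord.
rewrite cardsT !card_ord; have:= F_card i; have:= k_gt0 i.
by case: (k i) => // m _; rewrite !subn1.
Qed.
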